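(* Let $(X,M,\ast)$ be a complete fuzzy metric space, let $g\colon X\to X$ be a bijective function, let $A$ be a nonempty closed subset of $X$, let $\varphi\in\Phi$, and let $T\colon A\to \mathrm{cl}(A)$, where $\mathrm{cl}(A)$ denotes the family of all nonempty closed subsets of $A$. Suppose that $T$ is a (multivalued) fuzzy $(g,\varphi)$-contraction with respect to this $g$, i.e. for all $x,y\in X$ with $g(x),g(y)\in A$ and every $t>0$: if $M(gx,gy,t)>1-t$, then for every $u\in T(g(x))$ there exists $v\in T(g(y))$ such that $M(u,v,\varphi(t))>1-\varphi(t)$. Suppose moreover that $T$ is weakly fuzzy demicompact. Then there exists at least one element $x\in A$ such that $x\in Tx$.
   Context: A continuous $t$-norm is a binary operation $\ast\colon[0,1]\times[0,1]\to[0,1]$ such that $([0,1],\ast)$ is a topological monoid (i.e. $\ast$ is associative and continuous) with unit $1$, and $a\ast b\le c\ast d$ whenever $a\le c$ and $b\le d$. A fuzzy metric space is a triple $(X,M,\ast)$ where $X$ is a set, $\ast$ is a continuous $t$-norm and $M\colon X\times X\times[0,+\infty)\to[0,1]$ satisfies, for all $x,y,z\in X$ and $s,t>0$: (FM1) $M(x,y,0)=0$; (FM2) $M(x,y,t)>0$; (FM3) $M(x,y,t)=1$ if and only if $x=y$; (FM4) $M(x,y,t)=M(y,x,t)$; (FM5) $M(x,z,t+s)\ge M(x,y,t)\ast M(y,z,s)$; (FM6) $M(x,y,\cdot)\colon(0,+\infty)\to[0,1]$ is continuous. A sequence $\{x_n\}$ in $X$ (fuzzy) converges to $x\in X$ if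 $\lim_{n\to\infty}M(x_n,x,t)=1$ for all $t>0$. It is a fuzzy Cauchy sequence if for every $t>0$ one has $M(x_m,x_n,t)\to1$ as $m,n\to\infty$. The space is complete if every fuzzy Cauchy sequence converges to a point of $X$. The closure of a nonempty $B\subseteq X$ is $\overline B=\{y\in X:\ \text{for all }\epsilon>0,\ \lambda\in(0,1)\text{ there is }x\in B\text{ with }M(x,y,\epsilon)>1-\lambda\}$, and $B$ is closed if $B=\overline B$. $\Phi$ is the class of all mappings $\varphi\colon[0,+\infty)\to[0,+\infty)$ that are nondecreasing, right continuous, and satisfy $\lim_{n\to+\infty}\varphi^n(t)=0$ for every $t>0$, where $\varphi^n$ is the $n$-fold iterate. A mapping $T$ from $A$ to the nonempty subsets of $X$ is weakly fuzzy demicompact if every sequence $\{x_n\}$ in $A$ such that $x_{n+1}\in Tx_n$ for all $n\in\mathbb N$ and $\lim_{n\to+\infty}M(x_{n+1},x_n,t)=1$ for every $t>0$ has a fuzzy convergent subsequence. *)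

(* Defs.v *)
From HB Require Import structures.
From mathcomp Require Export all_boot all_order all_algebra.
From mathcomp Require Export all_classical all_reals all_analysis.
Set Implicit Arguments.
Unset Strict Implicit.
Unset Printing Implicit Defensive.
Export Order.TTheory GRing.Theory Num.Theory.
Export numFieldNormedType.Exports.
Local Open Scope classical_set_scope.
Local Open Scope ring_scope.

(* Maps defined on [0, 1], [0, +oo) or on a subset A of X are represented by
   total functions; every axiom below only concerns arguments in the intended
   domain, so the values elsewhere are irrelevant. *)

Record continuous_tnorm (R : realType) (star : R -> R -> R) : Prop := {
  tnorm_itv : forall a b : R, 0 <= a <= 1 -> 0 <= b <= 1 -> 0 <= star a b <= 1;
  tnormA : forall a b c : R, 0 <= a <= 1 -> 0 <= b <= 1 -> 0 <= c <= 1 ->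
    star a (star b c) = star (star a b) c;
  tnorm_continuous :
    {within `[0, 1] `*` `[0, 1], continuous (fun p : R * R => star p.1 p.2)};
  tnorm1l : forall a : R, 0 <= a <= 1 -> star 1 a = a;
  tnorm1r : forall a : R, 0 <= a <= 1 -> star a 1 = a;
  tnorm_le : forall a b c d : R, 0 <= a <= 1 -> 0 <= b <= 1 ->
    0 <= c <= 1 -> 0 <= d <= 1 -> a <= c -> b <= d -> star a b <= star c d }.

Record fuzzy_metric (R : realType) (X : Type) (M : X -> X -> R -> R)
    (star : R -> R -> R) : Prop := {
  fm_tnorm : continuous_tnorm star;
  fm_itv : forall x y (t : R), 0 <= t -> 0 <= M x y t <= 1;
  fm1 : forall x y, M x y 0 = 0;
  fm2 : forall x y (t : R), 0 < t -> 0 < M x y t;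
  fm3 : forall x y (t : R), 0 < t -> (M x y t = 1 <-> x = y);
  fm4 : forall x y (t : R), 0 < t -> M x y t = M y x t;
  fm5 : forall x y z (s t : R), 0 < s -> 0 < t ->
    star (M x y t) (M y z s) <= M x z (t + s);
  fm6 : forall x y, {within `]0, +oo[, continuous (M x y)} }.

Definition fuzzy_cvg (R : realType) (X : Type) (M : X -> X -> R -> R)
    (x_ : nat -> X) (x : X) : Prop :=
  forall t : R, 0 < t -> M (x_ n) x t @[n --> \oo] --> (1 : R).

Definition fuzzy_cauchy (R : realType) (X : Type) (M : X -> X -> R -> R)
    (x_ : nat -> X) : Prop :=
  forall t : R, 0 < t -> M (x_ p.1) (x_ p.2) t @[p --> (\oo, \oo)] --> (1 : R).

Definition fuzzy_complete (R : realType) (X : Type) (M : X -> X -> R -> R)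
    : Prop :=
  forall x_, fuzzy_cauchy M x_ -> exists x, fuzzy_cvg M x_ x.

Definition fuzzy_closure (R : realType) (X : Type) (M : X -> X -> R -> R)
    (B : set X) : set X :=
  [set y | forall e l : R, 0 < e -> 0 < l < 1 ->
    exists2 x, B x & 1 - l < M x y e].

Definition fuzzy_closed (R : realType) (X : Type) (M : X -> X -> R -> R)
    (B : set X) : Prop :=
  B = fuzzy_closure M B.

Record class_Phi (R : realType) (phi : R -> R) : Prop := {
  Phi_ge0 : forall t : R, 0 <= t -> 0 <= phi t;
  Phi_nondecreasing : forall s t : R, 0 <= s -> s <= t -> phi s <= phi t;
  Phi_right_continuous : forall t : R, 0 <= t -> phi s @[s --> t^'+] --> phi t;
  Phi_iter : forall t : R, 0 < t -> iter n phi t @[n --> \oo] --> (0 : R) }.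

Definition fuzzy_contraction (R : realType) (X : Type) (M : X -> X -> R -> R)
    (A : set X) (g : X -> X) (phi : R -> R) (T : X -> set X) : Prop :=
  forall x y, A (g x) -> A (g y) -> forall t : R, 0 < t ->
    1 - t < M (g x) (g y) t ->
    forall u, T (g x) u ->
      exists2 v, T (g y) v & 1 - phi t < M u v (phi t).

Definition weakly_fuzzy_demicompact (R : realType) (X : Type)
    (M : X -> X -> R -> R) (A : set X) (T : X -> set X) : Prop :=
  forall x_ : nat -> X,
    (forall n, A (x_ n)) ->
    (forall n, T (x_ n) (x_ n.+1)) ->
    (forall t : R, 0 < t -> M (x_ n.+1) (x_ n) t @[n --> \oo] --> (1 : R)) ->
    exists k : nat -> nat, {homo k : m n / (m < n)%N} /\
      exists x, fuzzy_cvg M (x_ \o k) x.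

(* Main.v *)
(** Starting from x_0 in A and x_1 in T x_0, one has M x_0 x_1 2 > 0 > 1 - 2, so the
    contraction produces successively x_(n+1) in T x_n with
    M x_n x_(n+1) (phi^n 2) > 1 - phi^n 2.  As phi^n 2 tends to 0, demicompactness gives a
    subsequence converging to some x in A.  Since phi t < t, the contraction applied to
    x_(k n) and x gives points of T x as close as desired to x_(k n + 1), hence to x, and
    T x is closed. *)
Require Import Defs.
From mathcomp Require Import lra.
Local Open Scope classical_set_scope.
Local Open Scope ring_scope.

Section ClassPhi.
Set Implicit Arguments.
Unset Strict Implicit.
Variables (R : realType) (phi : R -> R).
Hypothesis Hphi : class_Phi phi.

(** If [t <= phi t], monotonicity keeps every iterate above [t], so the iterates cannot tend to
    0. *)
Lemma Phi_lt (t : R) : 0 < t -> phi t < t.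
Proof.
move=> t0; rewrite ltNge; apply/negP => tphi.
have le_iter n : t <= iter n phi t.
  elim: n => [|n IHn] //=; apply: le_trans tphi _.
  exact: (Phi_nondecreasing Hphi (ltW t0)).
have /cvgrPdist_lt /(_ _ t0) [N _ /(_ N (leqnn N))] /= := Phi_iter Hphi t0.
by rewrite sub0r normrN ger0_norm ?(le_trans (ltW t0)) // ltNge le_iter.
Qed.

End ClassPhi.

(** This is continuity of [star] at the corner [(1, 1)] of the unit square, where its value is 1. *)
Lemma tnorm_near1 (R : realType) (star : R -> R -> R) :
  continuous_tnorm star -> forall l : R, 0 < l ->
  exists2 d : R, 0 < d & forall a b : R, 0 <= a <= 1 -> 0 <= b <= 1 ->
    1 - d < a -> 1 - d < b -> 1 - l < star a b.
Proof.
move=> Hs l l0.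
have I1 : (`[0, 1] `*` `[0, 1] : set (R * R)) (1, 1).
  by split; rewrite /= in_itv /= ler01 lexx.
have /subspace_continuousP /(_ _ I1) /cvgrPdist_lt /(_ _ l0) := tnorm_continuous Hs.
rewrite near_withinE => /nbhs_ballP [d /= d0 Hd].
exists d => // a b /andP[a0 a1] /andP[b0 b1] da db.
have Bab : ball ((1, 1) : R * R) d (a, b).
  by split; rewrite /ball /= ger0_norm ?subr_ge0 // ltrBlDl -ltrBlDr.
have Iab : (`[0, 1] `*` `[0, 1] : set (R * R)) (a, b).
  by split; rewrite /= in_itv /= ?a0 ?a1 ?b0 ?b1.
have := Hd _ Bab Iab; rewrite /from_subspace /=.
rewrite (tnorm1l Hs) ?ler01 ?lexx // => /(le_lt_trans (ler_norm _)).
by rewrite ltrBlDl -ltrBlDr.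
Qed.

Section FuzzyMetric.
Set Implicit Arguments.
Unset Strict Implicit.
Variables (R : realType) (X : Type) (M : X -> X -> R -> R) (star : R -> R -> R).
Hypothesis HM : fuzzy_metric M star.

(** One scale serves as both time and tolerance, as in the contraction condition. For small [t > 0]
    these relations behave like entourages of a uniformity. *)
Definition fuzzy_near (t : R) (x y : X) := 1 - t < M x y t.

(** In the triangle inequality through [y] itself, the extra time [t - s] goes to the pair [(y, y)],
    whose value is the unit 1. *)
Lemma fuzzy_metric_le x y (s t : R) : 0 < s -> s <= t -> M x y s <= M x y t.
Proof.
move=> s0; rewrite le_eqVlt => /predU1P[-> //|st].
have ts0 : 0 < t - s by rewrite subr_gt0.
have := fm5 HM x y y ts0 s0.
have /(fm3 HM y y ts0) -> := erefl y.
by rewrite (tnorm1r (fm_tnorm HM)) ?(fm_itv HM _ _ (ltW s0)) // addrCA subrr addr0.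
Qed.

Lemma fuzzy_near_le x y (s t : R) :
  0 < s -> s <= t -> fuzzy_near s x y -> fuzzy_near t x y.
Proof.
rewrite /fuzzy_near => s0 st sxy.
by have := fuzzy_metric_le x y s0 st; lra.
Qed.

Lemma fuzzy_nearC x y (t : R) : 0 < t -> fuzzy_near t x y -> fuzzy_near t y x.
Proof. by move=> t0; rewrite /fuzzy_near (fm4 HM). Qed.

Lemma fuzzy_near_trans (e : R) : 0 < e ->
  exists2 d : R, 0 < d & forall x y z,
    fuzzy_near d x y -> fuzzy_near d y z -> fuzzy_near e x z.
Proof.
move=> e0; have [d d0 Hd] := tnorm_near1 (fm_tnorm HM) e0.
(* The bound [d] controls the t-norm of the two values, and [e / 2] keeps the sum of the two times
   below [e]. *)
have m0 : 0 < Num.min d (e / 2) by rewrite lt_min d0 divr_gt0.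
exists (Num.min d (e / 2)) => // x y z.
set m := Num.min _ _ in m0 *.
have md : m <= d by rewrite ge_min lexx.
have me : m + m <= e.
  by rewrite [e]splitr; apply: lerD; rewrite ge_min lexx orbT.
rewrite /fuzzy_near => xy yz.
have Hxyz : 1 - e < star (M x y m) (M y z m).
  by apply: Hd; rewrite ?(fm_itv HM _ _ (ltW m0)) //; lra.
apply: lt_le_trans Hxyz (le_trans (fm5 HM _ _ _ m0 m0) _).
by apply: fuzzy_metric_le => //; rewrite addr_gt0.
Qed.

(** Taking [y_] constant gives convergence to a point; taking [x_] to be the shift of [y_] gives the
    demicompactness condition. *)
Lemma cvg_fuzzy_near (x_ y_ : nat -> X) :
  (forall t : R, 0 < t -> M (x_ n) (y_ n) t @[n --> \oo] --> (1 : R)) <->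
  (forall t : R, 0 < t -> \forall n \near \oo, fuzzy_near t (x_ n) (y_ n)).
Proof.
split=> H t t0.
  have /cvgrPdist_lt /(_ _ t0) := H t t0.
  apply: filterS => n /(le_lt_trans (ler_norm _)).
  by rewrite /fuzzy_near ltrBlDl -ltrBlDr.
apply/cvgrPdist_lt => e e0.
(* The minimum brings the separate time [t] and tolerance [e] under a single scale. *)
have m0 : 0 < Num.min t e by rewrite lt_min t0.
apply: filterS (H _ m0) => n; rewrite /fuzzy_near => Hn.
have mt : Num.min t e <= t by rewrite ge_min lexx.
have me : Num.min t e <= e by rewrite ge_min lexx orbT.
have /andP[_ M1] := fm_itv HM (x_ n) (y_ n) (ltW t0).
have := fuzzy_metric_le (x_ n) (y_ n) m0 mt.
rewrite ger0_norm ?subr_ge0 //; lra.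
Qed.

Lemma fuzzy_closed_near (B : set X) x : fuzzy_closed M B ->
  (forall e : R, 0 < e -> exists2 y, B y & fuzzy_near e y x) -> B x.
Proof.
move=> BE H; rewrite BE => e l e0 /andP[l0 _].
have m0 : 0 < Num.min e l by rewrite lt_min e0.
have [y By yx] := H _ m0; exists y => //.
have me : Num.min e l <= e by rewrite ge_min lexx.
have ml : Num.min e l <= l by rewrite ge_min lexx orbT.
have := fuzzy_metric_le y x m0 me; rewrite /fuzzy_near in yx; lra.
Qed.

Section Contraction.
Variables (g : X -> X) (A : set X) (phi : R -> R) (T : X -> set X).
Hypothesis Hg : bijective g.
Hypothesis HA0 : A !=set0.
Hypothesis Hphi : class_Phi phi.
Hypothesis HT0 : forall a, A a -> T a !=set0.
Hypothesis HTA : forall a, A a -> T a `<=` A.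
Hypothesis Hcontr : fuzzy_contraction M A g phi T.

(** Writing [a] and [b] as images under [g] of their preimages removes [g] from the contraction
    condition. *)
Lemma contraction_near a b (t : R) u : A a -> A b -> 0 < t ->
  fuzzy_near t a b -> T a u -> exists2 v, T b v & fuzzy_near (phi t) u v.
Proof.
case: Hg => h _ gK; rewrite -[a]gK -[b]gK => Aa Ab t0 ab Tu.
exact: (Hcontr Aa Ab t0 ab Tu).
Qed.

(* If phi t = 0, the contraction applied to a pair (a, a) would give M u v 0 > 1. *)
Lemma contraction_phi_gt0 (t : R) : 0 < t -> 0 < phi t.
Proof.
move=> t0; rewrite lt_neqAle (Phi_ge0 Hphi (ltW t0)) andbT.
apply/eqP => phi0; have [a Aa] := HA0; have [u Tu] := HT0 Aa.
have aa : fuzzy_near t a a.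
  by rewrite /fuzzy_near (proj2 (fm3 HM a a t0) erefl) ltrBlDr ltrDl.
have [v _] := contraction_near Aa Aa t0 aa Tu.
by rewrite /fuzzy_near -phi0 (fm1 HM) subr0 ltr10.
Qed.

Lemma contraction_orbit : exists x_ : nat -> X,
  [/\ forall n, A (x_ n), forall n, T (x_ n) (x_ n.+1) &
      forall n, fuzzy_near (iter n phi 2) (x_ n) (x_ n.+1)].
Proof.
(* A state holds two consecutive orbit points and their scale. Choosing a successor for every state
   at once turns dependent choice into plain iteration of a function. *)
pose good (p : X * X * R) :=
  [/\ A p.1.1, T p.1.1 p.1.2, 0 < p.2 & fuzzy_near p.2 p.1.1 p.1.2].
have /choice [f Hf] (p : X * X * R) :
    exists c, good p -> good (p.1.2, c, phi p.2).
  have [gp|ngp] := pselect (good p); last by exists p.1.1.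
  have [Aa Tb t0 ab] := gp; have Ab := HTA Aa Tb.
  have [c Tc bc] := contraction_near Aa Ab t0 ab Tb.
  by exists c => _; split => //=; exact: contraction_phi_gt0.
have [a Aa] := HA0; have [b Tb] := HT0 Aa.
pose s n := iter n (fun p => (p.1.2, f p, phi p.2)) (a, b, 2 : R).
have s2 n : (s n).2 = iter n phi 2 by elim: n => //= n ->.
have gs n : good (s n).
  elim: n => [|n IHn]; last exact: Hf.
  split => //=; rewrite /fuzzy_near.
  by have := fm2 HM a b (ltr0n R 2); lra.
by exists (fun n => (s n).1.1); split=> n; have [] := gs n; rewrite ?s2.
Qed.

End Contraction.

End FuzzyMetric.

Theorem theorem21 (R : realType) (X : Type) (M : X -> X -> R -> R)
    (star : R -> R -> R) (HM : fuzzy_metric M star) (HX : fuzzy_complete M)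
    (g : X -> X) (Hg : bijective g)
    (A : set X) (HA0 : A !=set0) (HA : fuzzy_closed M A)
    (phi : R -> R) (Hphi : class_Phi phi)
    (T : X -> set X)
    (HT : forall a, A a -> [/\ T a !=set0, fuzzy_closed M (T a) & T a `<=` A])
    (Hcontr : fuzzy_contraction M A g phi T)
    (Hdemi : weakly_fuzzy_demicompact M A T) :
  exists2 x, A x & T x x.
Proof.
have HT0 a : A a -> T a !=set0 by case/HT.
have HTA a : A a -> T a `<=` A by case/HT.
have phi_gt0 := contraction_phi_gt0 HM Hg HA0 Hphi HT0 Hcontr.
have [x_ [Ax_ Tx_ near_x_]] := contraction_orbit HM Hg HA0 Hphi HT0 HTA Hcontr.
have step (t : R) : 0 < t ->
    \forall n \near \oo, fuzzy_near M t (x_ n.+1) (x_ n).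
  move=> t0; have /cvgrPdist_lt /(_ _ t0) := Phi_iter Hphi (ltr0n R 2).
  apply: filterS => n; rewrite sub0r normrN => /(le_lt_trans (ler_norm _)) /ltW.
  have i0 : 0 < iter n phi 2 by elim: n => //= n; exact: phi_gt0.
  move=> /(fuzzy_near_le HM i0) le_t.
  by apply: (fuzzy_nearC HM) => //; exact/le_t/near_x_.
have [k [k_mono [x cvgx]]] := Hdemi x_ Ax_ Tx_ (proj2 (cvg_fuzzy_near HM _ _) step).
(* Index thresholds for the whole orbit thus also apply along the subsequence. *)
have le_k n : (n <= k n)%N.
  by elim: n => // n IHn; apply: leq_ltn_trans IHn (k_mono _ _ (ltnSn n)).
have near_x := proj1 (cvg_fuzzy_near HM _ _) cvgx.
have Ax : A x.
  apply: (fuzzy_closed_near HM HA) => e e0.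
  by have [N _ /(_ N (leqnn N))] := near_x e e0; exists (x_ (k N)).
exists x => //; have [_ cTx _] := HT _ Ax.
apply: (fuzzy_closed_near HM cTx) => e e0.
(* Two nested triangle inequalities are used: [v] to [x_ (k n).+1] and [x_ (k n).+1] to [x] at scale
   [d], the latter split at [x_ (k n)] into two hops at scale [d']. *)
have [d d0 trans_e] := fuzzy_near_trans HM e0.
have [d' d'0 trans_d] := fuzzy_near_trans HM d0.
have [N1 _ step_d'] := step d' d'0.
have [N2 _ near_d] := near_x d d0.
have [N3 _ near_d'] := near_x d' d'0.
pose n := maxn N1 (maxn N2 N3).
have N1n : (N1 <= k n)%N by apply: leq_trans (le_k n); rewrite leq_maxl.
have N2n : (N2 <= n)%N by rewrite !leq_max leqnn orbT.
have N3n : (N3 <= n)%N by rewrite !leq_max leqnn !orbT.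
have [v Tv uv] := contraction_near Hg Hcontr (Ax_ _) Ax d0 (near_d n N2n) (Tx_ _).
exists v => //; apply: (trans_e _ (x_ (k n).+1)).
  apply: (fuzzy_nearC HM) => //.
  (* The contraction gives scale [phi d], which is positive and below [d]. *)
  by apply: (fuzzy_near_le HM) uv; [exact: phi_gt0|exact/ltW/Phi_lt].
exact: trans_d (step_d' _ N1n) (near_d' n N3n).
Qed.
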